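(* Let $X$ be a hereditarily unicoherent continuum and let $x\in X$. If the meager composant $M_x$ of $x$ is open in $X$, then $M_x=X$.
   Context: A continuum is a nonempty compact connected metric space; a subcontinuum of $X$ is a subset of $X$ that is a continuum in the subspace topology (one-point sets are allowed as subcontinua). A continuum $X$ is hereditarily unicoherent if for every two subcontinua $A,B$ of $X$ the intersection $A\cap B$ is connected (the empty set counts as connected). For a continuum $X$ and $x\in X$, the meager composant of $x$ in $X$ is $M_x=\bigcup\{L\subset X: L$ is a nowhere dense subcontinuum of $X$ and $x\in L\}$.
   Formalization: The continuum X is additionally assumed to have at least two points; for a one-point X the meager composant is empty, hence open but different from X, so the claim fails there. *)

(* Defs.v *)
From HB Require Import structures.
From mathcomp Require Import all_boot all_order all_algebra.
From mathcomp Require Import all_classical all_reals all_analysis.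

Set Implicit Arguments.
Unset Strict Implicit.
Unset Printing Implicit Defensive.

Local Open Scope classical_set_scope.

(* [compact A] and [connected A] are intrinsic to the subspace topology of [A],
   so this also serves as "[A] is a subcontinuum of [T]"; metrizability comes
   from the ambient space. *)
Definition is_continuum (T : topologicalType) (A : set T) : Prop :=
  [/\ A !=set0, compact A & connected A].

Definition nowhere_dense (T : topologicalType) (A : set T) : Prop :=
  interior (closure A) = set0.

(* [connected set0] holds for the library's [connected]. *)
Definition hereditarily_unicoherent (T : topologicalType) : Prop :=
  forall A B : set T, is_continuum A -> is_continuum B -> connected (A `&` B).

Definition meager_composant (T : topologicalType) (x : T) : set T :=
  \bigcup_(L in [set L : set T | [/\ is_continuum L, nowhere_dense L & L x]]) L.

(* Main.v *)
(** Suppose M = M_x is open and p lies in its closure but not in M, and let K be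
   the smallest continuum containing x and p. Then K lies in the closure of M
   and has interior points, since otherwise p would be in M. As M is exhausted
   by closed sets A_n that absorb every compact subset of M, the continua
   D_n = K /\ (component of x in A_n) cover M /\ int K, so by Baire some D = D_n
   has interior. By irreducibility of K, the closure N of K \ D is a continuum;
   it contains p and meets D at some y in M. If L is a nowhere dense continuum
   containing x and y, then (L /\ K) \/ N is a continuum containing x and p,
   hence contains K, which forces int D to lie in L: a contradiction. *)

Require Import Defs.
From HB Require Import structures.
From mathcomp Require Import all_boot all_order all_algebra.
From mathcomp Require Import all_classical all_reals all_analysis.

Import Order.TTheory GRing.Theory Num.Theory.

Local Open Scope classical_set_scope.

(** If no member lay in [O], the sets [C]\[O] would generate a proper filter; a cluster point of it
    lies in every member but not in [O]. *)
Lemma directed_bigcap_sub_open {T : topologicalType} (FF : set (set T))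
    (O : set T) :
  FF !=set0 -> (forall C, FF C -> closed C /\ compact C) ->
  (forall B C, FF B -> FF C -> exists2 D, FF D & D `<=` B `&` C) ->
  open O -> \bigcap_(C in FF) C `<=` O -> exists2 C, FF C & C `<=` O.
Proof.
move=> [C0 FC0] cFF dFF oO sub; apply: contrapT => noC.
pose G := filter_from FF (fun C => C `\` O).
have FG : ProperFilter G.
  apply: filter_from_proper; last first.
    move=> C FC; apply: contrapT => /nonemptyPn CO; apply: noC; exists C => //.
    by rewrite -setD_eq0.
  apply: filter_from_filter; first by exists C0.
  move=> B C /dFF/[apply] -[D FD DBC]; exists D => // z [/DBC[]].
  by split; split.
have [|p [_ clp]] := (cFF C0 FC0).2 G _; first by exists C0 => // z [].
have GCp C : FF C -> (C `\` O) p.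
  move=> FC; have cCO : closed (C `\` O).
    by apply: closedI; [exact: (cFF C FC).1 | exact: open_closedC].
  by apply: cCO => B nB; apply: clp => //; exists C.
by have [_] := GCp C0 FC0; apply; apply: sub => C /GCp[].
Qed.

(** Two separated pieces of the intersection are closed, so normality gives them disjoint open
    neighbourhoods. Some member already lies in their union, hence on one side, which empties the
    other piece. *)
Lemma directed_bigcap_connected {T : topologicalType} (FF : set (set T)) :
  hausdorff_space T -> compact [set: T] ->
  FF !=set0 -> (forall C, FF C -> closed C /\ connected C) ->
  (forall B C, FF B -> FF C -> exists2 D, FF D & D `<=` B `&` C) ->
  connected (\bigcap_(C in FF) C).
Proof.
move=> hT cT FF0 cFF dFF; apply/connectedP => E [E0 EU [s1 s2]].
set K := \bigcap_(C in FF) C in EU.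
have cK : closed K by apply: closed_bigI => C /cFF[].
have sK b : E b `<=` K by rewrite EU; case: b => z; [right|left].
have cE b : closed (E b).
  move=> z Ez; have : K z by apply: cK; exact: (closureS (sK b)) Ez.
  rewrite EU; case: b Ez => Ez [] // Ez'.
    by exfalso; rewrite -[False]/(set0 z) -s2.
  by exfalso; rewrite -[False]/(set0 z) -s1.
have E12 : E false `&` E true = set0.
  by rewrite -s1; congr (_ `&` _); exact/closure_id.
have [|N /set_nbhsP[U [oU EfU UN]] NEt] :=
    compact_normal hT cT (cE false) (t := ~` E true).
  apply/set_nbhsP; exists (~` E true); split => //.
    by apply: closed_openC.
  exact/disjoints_subset.
have EtN : E true `<=` ~` closure N by move=> z Ez /NEt.
have sepUN : separated U (~` closure N).
  split; apply/disjoints_subset.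
    by rewrite setCK; exact: closureS.
  move=> z Uz /(_ U (open_nbhs_nbhs (conj oU Uz)))[w [wN Uw]].
  by apply: wN; apply: subset_closure; exact: UN.
have [] := @directed_bigcap_sub_open _ FF (U `|` ~` closure N) FF0 _ dFF.
- move=> C /cFF[cC _]; split => //.
  exact: subclosed_compact cC cT _.
- by apply: openU => //; exact/closed_openC/closed_closure.
- by rewrite -/K EU => z [/EfU|/EtN]; [left|right].
move=> C FC CU; have KC : K `<=` C by move=> z; exact.
have [_ kC] := cFF _ FC.
have [CsU|CsN] := connected_subset sepUN CU kC.
  have [z Ez] := E0 true; have /CsU/UN/subset_closure Nz := KC z (sK true z Ez).
  exact: EtN Ez Nz.
have [z Ez] := E0 false; have /CsN := KC z (sK false z Ez).
by apply; apply: subset_closure; apply/UN/EfU.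
Qed.

(** In a separation of [A]|[D] one side contains [D]. The other side then lies in [A], so it is
    separated from [B] as well and would split [K]. *)
Lemma setD_separated_connected {T : topologicalType} (K D A B : set T) :
  connected K -> connected D -> D !=set0 -> D `<=` K -> K `\` D = A `|` B ->
  separated A B -> connected (A `|` D).
Proof.
move=> cK cD [d Dd] DK KDE [sAB sBA]; apply/connectedP => E [E0 EU sE].
wlog DE : E E0 EU sE / D `<=` E false.
  move=> wl; have := connected_subset sE _ cD; rewrite -EU.
  case=> [|DE|DE]; [exact: subsetUr|exact: (wl E E0 EU sE DE)|].
  apply: (wl (E \o negb)) => //=.
    by rewrite EU setUC.
  by rewrite separatedC.
have E12 := separated_disjoint sE; case: sE => s1 s2.
have EtA : E true `<=` A.
  move=> z Ez; have : (A `|` D) z by rewrite EU; right.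
  by case=> // /DE Efz; exfalso; rewrite -[False]/(set0 z) -E12.
have KA : A `<=` K by move=> z Az; have [] : (K `\` D) z by rewrite KDE; left.
have sep : separated (E false `|` B) (E true).
  split; rewrite -subset0 => z.
    rewrite closureU => -[[Ez|Bz] Etz]; first by rewrite -s1.
    by exfalso; rewrite -[False]/(set0 z) -sBA; split => //; exact: EtA.
  move=> [[Ez|Bz] Etz]; first by rewrite -s2.
  by rewrite -sAB; split => //; exact: closureS EtA _ Etz.
have [|Kl|Kr] := connected_subset sep _ cK.
- move=> z Kz; have [/DE|nDz] := pselect (D z); first by left; left.
  have : (A `|` B) z by rewrite -KDE.
  move=> [Az|]; last by left; right.
  have : (A `|` D) z by left.
  by rewrite EU => -[]; [left; left|right].
- have [z Etz] := E0 true; have := separated_disjoint sep.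
  by move/seteqP => [/(_ z)] + _; apply; split => //; apply: Kl; exact/KA/EtA.
- have := separated_disjoint sep.
  move/seteqP => [/(_ d)] + _; apply; split; first by left; exact: DE.
  by apply/Kr/DK.
Qed.

(** If [K]\[D] splits, the piece containing [p] together with [D] is closed and connected and
    contains [x] and [p]. By irreducibility it is all of [K], so the other piece is empty. *)
Lemma irreducible_setD_connected {T : topologicalType} (K D : set T) (x p : T) :
  closed K -> connected K -> closed D -> connected D ->
  D `<=` K -> D x -> K p -> ~ D p ->
  (forall C, closed C -> connected C -> C x -> C p -> C `<=` K -> K `<=` C) ->
  connected (K `\` D).
Proof.
move=> clK cK clD cD DK Dx Kp Dp Kirr; apply/connectedP => E [E0 EU sE].
wlog Efp : E E0 EU sE / E false p.
  move=> wl; have : (K `\` D) p by [].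
  rewrite EU => -[Ep|Ep]; first exact: (wl E E0 EU sE Ep).
  apply: (wl (E \o negb)) => //=.
    by rewrite EU setUC.
  by rewrite separatedC.
have EK b : E b `<=` K `\` D by rewrite EU; case: b => z; [right|left].
have [z Etz] := E0 true; have [Kz Dz] := EK true z Etz.
have [|||||Efz|//] := Kirr (E false `|` D) _ _ _ _ _ z Kz.
- move=> w; rewrite closureU => -[Ew|Dw]; last by right; exact: clD.
  have [Dw|Dw] := pselect (D w); [by right|left].
  have : (K `\` D) w.
    split => //; apply: clK; apply: closureS Ew.
    by move=> u /(EK false)[].
  rewrite EU => -[//|Etw]; exfalso; case: sE => s1 _.
  by rewrite -[False]/(set0 w) -s1.
- exact: (setD_separated_connected _ _ _ _ cK cD (ex_intro _ x Dx) DK EU sE).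
- by right.
- by left.
- by move=> w [/(EK false)[]|/DK].
- have := separated_disjoint sE.
  by move/seteqP => [/(_ z)] + _; apply.
Qed.

Lemma compact_baire {T : topologicalType} (U : set T) (F : nat -> set T) :
  hausdorff_space T -> compact [set: T] -> U !=set0 -> open U ->
  (forall n, closed (F n)) -> U `<=` \bigcup_n F n ->
  exists n, interior (F n) !=set0.
Proof.
move=> hT cT U0 oU cF UF; apply: contrapT => noF.
(* Bundling openness and nonemptiness lets the shrinking step be iterated by choice. *)
pose S := {V : set T | open V /\ V !=set0}.
have step n (V : S) : exists W : S, closure (sval W) `<=` sval V `\` F n.
  have [oV [v Vv]] := svalP V; set VV := sval V in oV Vv *.
  have [z [Vz Fz]] : (VV `\` F n) !=set0.
    apply: contrapT => /nonemptyPn; rewrite setD_eq0 => VF; apply: noF; exists n, v.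
    exact: filterS VF (open_nbhs_nbhs (conj oV Vv)).
  have nz : nbhs z (VV `\` F n).
    by apply: open_nbhs_nbhs; split => //; apply: openI => //; exact: closed_openC.
  have [|W nW cW] := compact_regular hT cT (x := z) _ nz; first exact: filterT.
  have W0 : W° !=set0 by exists z; apply: nbhs_singleton; exact: nbhs_interior.
  exists (exist _ W° (conj (open_interior W) W0)) => /=.
  by apply: subset_trans cW; apply: closureS; exact: interior_subset.
pose nxt n V := sval (cid (step n V)).
pose V := fix V n := if n is m.+1 then nxt m (V m) else exist _ U (conj oU U0) : S.
have VS n : closure (sval (V n.+1)) `<=` sval (V n) `\` F n.
  exact: (svalP (cid (step n (V n)))).
have mono m n : (m <= n)%N -> closure (sval (V n)) `<=` closure (sval (V m)).
  move=> /subnKC <-; elim: (n - m)%N => [|k IH]; first by rewrite addn0.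
  rewrite addnS; apply: subset_trans IH; apply: subset_trans (VS _) _.
  by move=> z [Vz _]; exact: subset_closure.
(* With [set0] as the open set: nested compact sets with empty intersection would include an empty
   one. *)
have [] := @directed_bigcap_sub_open _ (range (fun n => closure (sval (V n)))) set0.
- by exists (closure (sval (V 0%N))); exists 0%N.
- move=> _ [n _ <-]; have cV := @closed_closure _ (sval (V n)).
  by split => //; exact: subclosed_compact cV cT _.
- move=> _ _ [m _ <-] [n _ <-]; exists (closure (sval (V (maxn m n)))).
    by exists (maxn m n).
  by move=> z Vz; split; apply: mono Vz; rewrite ?leq_maxl ?leq_maxr.
- exact: open0.
- move=> z Vz; have Vn n : (sval (V n) `\` F n) z.
    by apply: VS; apply: Vz; exists n.+1.
  by have [n _ Fz] := UF z (Vn 0%N).1; have [] := Vn n.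
- move=> _ [n _ <-]; have [v Vv] := (svalP (V n)).2.
  by move=> /(_ v (subset_closure Vv)).
Qed.

Lemma open_compact_exhaustion {R : realType} {T : pseudoMetricType R}
    (M : set T) : open M ->
  exists A : nat -> set T, [/\ forall n, closed (A n), forall n, A n `<=` M &
    forall L, compact L -> L `<=` M -> exists n, L `<=` A n].
Proof.
move=> oM.
(* The points at distance at least about [1/(n+1)] from the complement of [M]; taking interiors of
   the balls makes [A n] closed. *)
pose A n := ~` \bigcup_(q in ~` M) (ball q n.+1%:R^-1%R : set T)°.
exists A; split.
- by move=> n; apply: open_closedC; apply: bigcup_open => q _; exact: open_interior.
- move=> n z Az; apply: contrapT => nMz; apply: Az; exists z => //.
  apply: nbhs_singleton; apply: nbhs_interior; apply: nbhsx_ballx.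
  by rewrite invr_gt0 ltr0Sn.
move=> L /compact_near_coveringP cL LM.
suff : \forall n \near \oo, L `<=` A n.
  by move=> /filter_ex[n Ln]; exists n.
apply: (cL _ \oo (fun n z => A n z)) => z Lz.
have /nbhs_ballP[e /= e0 eM] : nbhs z M by apply: open_nbhs_nbhs; split => //; exact: LM.
have e20 : (0 < e / 2)%R by rewrite divr_gt0.
near=> z' n => /=; move=> [q nMq /interior_subset qz'].
apply: nMq; apply: eM; rewrite [e]splitr; apply: (@ball_triangle _ _ z').
  by near: z'; exact: nbhsx_ballx.
apply: ball_sym; apply: le_ball qz'; apply: ltW; near: n.
exact: (near_infty_natSinv_lt (PosNum e20)).
Unshelve. all: end_near. Qed.

(** Hereditary unicoherence closes the subcontinua through [x] and [p] under binary intersection, so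
    the family is directed and its intersection is connected. *)
Lemma smallest_subcontinuum {T : topologicalType} (x p : T) :
  hausdorff_space T -> is_continuum [set: T] -> hereditarily_unicoherent T ->
  exists K : set T, [/\ is_continuum K, K x, K p &
    forall C, is_continuum C -> C x -> C p -> K `<=` C].
Proof.
move=> hT cT hu; have [_ kT nT] := cT.
pose FF := [set C : set T | [/\ is_continuum C, C x & C p]].
have clC (C : set T) : is_continuum C -> closed C by move=> [_ kC _]; exact: (compact_closed hT kC).
exists (\bigcap_(C in FF) C); split.
- split; first by exists x => C [].
    apply: (subclosed_compact _ kT) => //; apply: closed_bigI => C [cC _ _].
    exact: clC.
  apply: directed_bigcap_connected => //; first by exists setT.
    by move=> C [cC _ _]; split; [exact: clC|case: cC].
  move=> B C [cB Bx Bp] [cC Cx Cp]; exists (B `&` C) => //; split => //.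
  split; [by exists x| |exact: hu].
  by apply: compact_closedI; [case: cB|exact: clC].
- by move=> C [].
- by move=> C [].
- by move=> C cC Cx Cp z; apply.
Qed.

(* Nondegeneracy excludes the one-point space: its only nonempty subset is not
   nowhere dense, so there the meager composant is the open set set0. *)
Theorem theorem4 (R : realType) (X : metricType R)
    (X_continuum : is_continuum [set: X])
    (X_nondegenerate : exists y z : X, y <> z)
    (X_hu : hereditarily_unicoherent X)
    (x : X) :
  open (meager_composant x) -> meager_composant x = [set: X].
Proof.
have hX : hausdorff_space X := @metric_hausdorff R X.
have [_ kX nX] := X_continuum.
have clC (C : set X) : is_continuum C -> closed C.
  by move=> [_ kC _]; exact: (compact_closed hX kC).
have mkC (C : set X) : C !=set0 -> closed C -> connected C -> is_continuum C.
  by move=> C0 cC; split => //; exact: subclosed_compact cC kX _.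
set M := meager_composant x => oM; apply: contrapT => MX.
(* If [[set x]] had interior it would be clopen, and connectedness would reduce [X] to one point. *)
have Mx : M x.
  exists [set x] => //; have c1 : closed [set x].
    exact: (compact_closed hX (@compact_set1 _ x)).
  split=> //; first by apply: mkC => //; [exists x|exact: connected1].
  rewrite /nowhere_dense -(closure_id _).1//; apply: contrapT => /eqP/set0P[w xw].
  have [y [z yz]] := X_nondegenerate.
  have x1 : [set x] = [set: X].
    apply: nX; first by exists x.
      exists [set x]°; first exact: open_interior.
      rewrite setTI; apply/seteqP; split; last exact: interior_subset.
      by have wx : w = x := interior_subset xw; move=> u ->; move: xw; rewrite wx.
    by exists [set x]; rewrite ?setTI.
  have xE u : u = x by have : [set: X] u by []; rewrite -x1.
  by apply: yz; rewrite (xE y) (xE z).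
have cM : connected M.
  by apply: bigcup_connected; [exists x => L []|move=> L [[]]].
(* Otherwise [M] is nonempty and clopen in the connected space [X]. *)
have [p clMp Mp] : exists2 p, closure M p & ~ M p.
  apply: contrapT => noP; apply: MX; apply: nX; first by exists x.
    by exists M; rewrite ?setTI.
  exists M; rewrite ?setTI// => z Mz.
  by apply: contrapT => nMz; apply: noP; exists z.
have [K [cK Kx Kp Kmin]] := smallest_subcontinuum x p hX X_continuum X_hu.
have clK := clC _ cK; have [_ _ nK] := cK.
have KM : K `<=` closure M.
  apply: Kmin => //; last exact: subset_closure.
  apply: mkC; [by exists x; exact: subset_closure|exact: closed_closure|].
  exact: connected_closure.
pose U := K° `&` M.
have U0 : U !=set0.
  have [w Kw] : K° !=set0.
    apply: contrapT => /nonemptyPn K0; apply: Mp; exists K => //; split => //.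
    by rewrite /nowhere_dense -(closure_id _).1.
  have [u [Mu Ku]] := KM w (interior_subset Kw) _
    (open_nbhs_nbhs (conj (open_interior K) Kw)).
  by exists u.
have [A [cA AM exhA]] := open_compact_exhaustion M oM.
pose D n := K `&` connected_component (A n) x.
(* A nowhere dense continuum joining [x] to [z] stays in [M], so some [A n] contains it and, by
   connectedness, so does the component of [x]. *)
have UD : U `<=` \bigcup_n D n.
  move=> z [/interior_subset Kz [L [cL nL Lx] Lz]].
  have [_ kL cnL] := cL.
  have [|n LA] := exhA L kL.
    by move=> w Lw; exists L.
  by exists n => //; split => //; exists L.
have cD n : closed (D n) by apply: closedI => //; exact: component_closed.
have [n [w0 Dw0]] := compact_baire U D hX kX U0
  (openI (open_interior K) oM) cD UD.
have {w0 Dw0} [Dn0 intD] : D n !=set0 /\ (D n)° !=set0.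
  by split; exists w0 => //; exact: interior_subset.
(* The component of a point outside [A n] is empty by convention, so [D n] being nonempty forces [x]
   into [A n]. *)
have Cx : connected_component (A n) x x.
  apply: connected_component_refl; apply: contrapT => nAx.
  by case: Dn0 => z [_]; rewrite connected_component_out.
have nD : connected (D n).
  apply: X_hu => //; apply: mkC; first by exists x.
    exact: component_closed.
  exact: component_connected.
have DM : D n `<=` M.
  by move=> z [_ /connected_component_sub /AM].
have Dp : ~ D n p by move=> /DM.
have nKD : connected (K `\` D n).
  apply: (irreducible_setD_connected K (D n) x p) => //; first exact: subIsetl.
  by move=> C cC nC Cx' Cp _; apply: Kmin => //; apply: mkC => //; exists x.
set N := closure (K `\` D n).
(* Otherwise [D n] and its complement in [K] separate [K], with [x] in the first and [p] in the
   second. *)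
have [y Ny Dy] : exists2 y, N y & D n y.
  apply: contrapT => noy.
  have sep : separated (D n) (K `\` D n).
    split; rewrite -subset0 => z []; last by move=> Dz Nz; apply: noy; exists z.
    by move=> Dz [_ nDz]; apply: nDz; exact: cD.
  have [|KD|KD] := connected_subset sep _ nK.
  - by move=> z Kz; have [?|?] := pselect (D n z); [left|right].
  - exact/Dp/KD.
  - by have [_] := KD _ Kx; apply.
have [L [cL nL Lx] Ly] := DM _ Dy.
have Ky : K y by case: Dy.
have KLN : K `<=` (L `&` K) `|` N.
  apply: Kmin; [|by left|by right; apply: subset_closure].
  apply: mkC; first by exists x; left.
    apply: closedU; last exact: closed_closure.
    by apply: closedI => //; exact: clC.
  apply: connectedU; [by exists y|exact: X_hu|exact: connected_closure].
(* The interior of [D n] is an open set disjoint from [K]\[D n], so it misses the closure [N]. *)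
have DL : (D n)° `<=` closure L.
  move=> v Dv; have [Kv _] := interior_subset Dv.
  case: (KLN v Kv) => [[Lv _]|/(_ _ (open_nbhs_nbhs (conj (open_interior _) Dv)))].
    exact: subset_closure.
  by move=> [u [[_ nDu] /interior_subset]].
case: intD => v Dv; rewrite -[False]/(set0 v) -nL.
exact: filterS DL (open_nbhs_nbhs (conj (open_interior _) Dv)).
Qed.
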